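(* Let $\mathbb{H}\subset\mathbb{N}$, and assume that the densities $\mathcal{D}(\mathbb{H})$ and $\mathcal{D}(\mathbb{H}_{\mathcal{C}(\infty)})$ exist. Then $$\mathcal{D}(\mathbb{H})=\lim_{n\to\infty}\frac{\left\lfloor \frac{|\mathbb{H}\cap\mathbb{N}_n|}{2}\right\rfloor}{\left\lfloor\frac{n-1}{2}\right\rfloor}\leq \mathcal{D}(\mathbb{H}_{\mathcal{C}(\infty)})\leq \lim_{n\to\infty}\frac{|\mathbb{H}\cap\mathbb{N}_n|}{\left\lfloor\frac{n-1}{2}\right\rfloor}=2\mathcal{D}(\mathbb{H}).$$
   Context: $\mathbb{N}=\{1,2,\dots\}$ and $\mathbb{N}_n=\{1,\dots,n\}$. For $n\in\mathbb{N}$, the circle of partition $\mathcal{C}(n)=\mathcal{C}(n,\mathbb{N})$ has as points the symbols $[x]$ with $x\in\mathbb{N}$, $x<n$. An axis $\mathbb{L}_{[x],[y]}$ of $\mathcal{C}(n)$ is an unordered pair of distinct points $[x],[y]$ of $\mathcal{C}(n)$ with $x+y=n$ (the center $[n/2]$, if present, is not an axis point); there are $\lfloor (n-1)/2\rfloor$ axes. For $\mathbb{H}\subset\mathbb{N}$ define $$\mathcal{D}(\mathbb{H})=\lim_{n\to\infty}\frac{|\mathbb{H}\cap\mathbb{N}_n|}{n}$$ and $$\mathcal{D}(\mathbb{H}_{\mathcal{C}(\infty)})=\lim_{n\to\infty}\frac{\#\{\text{axes }\mathbb{L}_{[x],[y]}\text{ of }\mathcal{C}(n)\ :\ \{x,y\}\cap\mathbb{H}\neq\emptyset\}}{\lfloor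 (n-1)/2\rfloor},$$ each when the limit exists and is finite. *)

(* Defs.v *)
From mathcomp Require Import all_boot all_order all_algebra finmap.
From mathcomp Require Import all_classical all_reals all_analysis.

Set Implicit Arguments.
Unset Strict Implicit.
Unset Printing Implicit Defensive.

Import Order.TTheory GRing.Theory Num.Theory.
Import numFieldNormedType.Exports.

Local Open Scope classical_set_scope.
Local Open Scope ring_scope.

(* The index set N starts at 1. *)
Definition posnat : set nat := [set x | (0 < x)%N].

Definition posnat_upto (n : nat) : set nat := posnat `&` [set x | (x <= n)%N].

(* The point [x] of the circle of partition C(n) is represented by its weight
   x; the axis L_{[x],[y]}, an unordered pair, by the finite set {x, y}. *)
Definition cop_points (n : nat) : set nat := posnat `&` [set x | (x < n)%N].

Definition cop_axes (n : nat) : set {fset nat} :=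
  [set L | exists x y : nat, [/\ cop_points n x, cop_points n y, x <> y,
                                 (x + y)%N = n & L = [fset x; y]%fset]].

Definition cop_axes_meeting (H : set nat) (n : nat) : set {fset nat} :=
  cop_axes n `&` [set L | [set` L] `&` H !=set0].

(* [fset_set] is meaningful on finite sets only; see the finiteness lemmas
   below for the sets to which [card] is applied. *)
Definition card (T : choiceType) (A : set T) : nat := #|` fset_set A|%fset.

Definition count_upto (H : set nat) (n : nat) : nat :=
  card (H `&` posnat_upto n).

(* The value of these sequences at the finitely many n with a zero denominator
   is 0 and does not affect the limits. *)
Definition density_seq (R : realType) (H : set nat) : R^nat :=
  fun n => (count_upto H n)%:R / n%:R.

Definition axial_density_seq (R : realType) (H : set nat) : R^nat :=
  fun n => (card (cop_axes_meeting H n))%:R / ((n - 1)./2)%:R.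

Definition density (R : realType) (H : set nat) : R :=
  limn (density_seq R H).

Definition axial_density (R : realType) (H : set nat) : R :=
  limn (axial_density_seq R H).

Lemma finite_count_upto (H : set nat) (n : nat) :
  finite_set (H `&` posnat_upto n).
Proof.
by apply: (sub_finite_set _ (finite_II n.+1)) => x [_ [_ /= xn]].
Qed.

Lemma finite_cop_axes (n : nat) : finite_set (cop_axes n).
Proof.
apply: (@sub_finite_set _ _ ((fun x : nat => [fset x; (n - x)%N]%fset : {fset nat}) @` `I_n)).
  move=> L [x] [y] [[_ /= xn] _ _ xyn ->]; exists x => //=.
  by rewrite -xyn addKn.
exact/finite_image/finite_II.
Qed.

Lemma finite_cop_axes_meeting (H : set nat) (n : nat) :
  finite_set (cop_axes_meeting H n).
Proof. exact: sub_finite_set (@subIsetl _ _ _) (finite_cop_axes n). Qed.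

(* Main.v *)
(* Every axis meeting H contains one or two points of H, and every point of H
   in {1, .., n} other than n and n/2 lies on exactly one axis.  Hence, if h is
   the number of points of H up to n and a the number of axes meeting H,
   a <= h <= 2 a + 2, while (n-1)/2 and (h/2)/((n-1)/2) agree with n/2 and
   h/n up to bounded, resp. vanishing, errors. *)
Require Import Defs.
From mathcomp Require Import all_boot all_order all_algebra finmap.
From mathcomp Require Import all_classical all_reals all_analysis.
From mathcomp Require Import zify.

Import Order.TTheory GRing.Theory Num.Theory.
Import numFieldNormedType.Exports.

Local Open Scope classical_set_scope.
Local Open Scope ring_scope.

(** Being covered by a list already makes [A] finite, so [fset_set] keeps its intended meaning. The
    list may contain repetitions or elements outside [A]. *)
Lemma card_le_size (T : choiceType) (A : set T) (s : seq T) :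
  (forall x, A x -> x \in s) -> (Defs.card A <= size s)%N.
Proof.
move=> As.
have finA : finite_set A.
  by apply: (sub_finite_set _ (finite_seq s)) => x /As.
apply: uniq_leq_size; first exact: fset_uniq.
by move=> x; rewrite in_fset_set// inE => /As.
Qed.

Lemma count_upto_le (H : set nat) (n : nat) : (count_upto H n <= n)%N.
Proof.
rewrite -[leqRHS](size_iota 1); apply: card_le_size => x [_ [/= x0 xn]].
by rewrite mem_iota x0 add1n ltnS.
Qed.

(** Each axis meeting [H] is the image under [f] of one of its points in [H], so mapping [f] over
    these points lists all such axes. *)
Lemma card_axes_meeting_le (H : set nat) (n : nat) :
  (Defs.card (cop_axes_meeting H n) <= count_upto H n)%N.
Proof.
pose f x : {fset nat} := [fset x; (n - x)%N]%fset.
rewrite /count_upto /Defs.card -(size_map f); apply: card_le_size.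
move=> _ [[x [y [[/= x0 xn] [/= y0 yn] _ xyn ->]]] [z [/= zxy Hz]]].
apply/mapP; exists z.
  rewrite in_fset_set; last exact: finite_count_upto.
  rewrite inE; split => //.
  by move: zxy; rewrite !inE => /orP[] /eqP ->; split=> //=; exact: ltnW.
move: zxy; rewrite !inE /f => /orP[] /eqP ->.
  by rewrite -xyn addKn.
by rewrite -xyn addnK fsetUC.
Qed.

Lemma count_upto_le_axes (H : set nat) (n : nat) :
  (count_upto H n <= (Defs.card (cop_axes_meeting H n)).*2.+2)%N.
Proof.
set A := fset_set (cop_axes_meeting H n).
pose pt i (L : {fset nat}) := nth 0%N L i.
rewrite (_ : _.*2.+2 =
  size (n :: n./2 :: map (pt 0%N) A ++ map (pt 1%N) A)); last first.
  by rewrite /= size_cat !size_map addnn.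
apply: card_le_size => x [Hx [/= x0 xn]]; rewrite /posnat/= in x0.
rewrite !inE mem_cat.
have [//|xNn] := eqVneq x n; have [//|xNh] := eqVneq x n./2.
(* A point paired with itself would be the center, already excluded. *)
have [xE|xNx] := eqVneq x (n - x)%N; first by lia.
set L := [fset x; (n - x)%N]%fset.
have LA : L \in A.
  rewrite in_fset_set; last exact: finite_cop_axes_meeting.
  rewrite inE; split.
    exists x, (n - x)%N; split=> //; last by lia.
    - by split=> //=; lia.
    - by split; rewrite /posnat /=; lia.
    - by apply/eqP.
  by exists x; split=> //=; rewrite !inE eqxx.
(* The order in which [L] enumerates its two points is unknown, so [x] is located by its index, 0 or
   1. *)
have xL : x \in (L : seq nat) by rewrite -[_ \in _]/(x \in L) !inE eqxx.
have iL : (index x L < 2)%N.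
  by rewrite (leq_trans (_ : _ < size L)%N) ?index_mem// cardfs2; case: (_ != _).
have xE := nth_index 0%N xL.
case: (index x L) iL xE => [|[|//]] _ xE; apply/or3P.
  by apply: Or33; apply/orP; left; apply/mapP; exists L.
by apply: Or33; apply/orP; right; apply/mapP; exists L.
Qed.

Lemma cvg_inv_half (R : realType) :
  (fun n => ((n - 1)./2)%:R^-1 : R) @ \oo --> (0 : R).
Proof.
(* The factor 5 gives [n + 1 <= 5 * (n - 1)./2] for all [n >= 3], with equality at [n = 4]. *)
have h0 : (fun n => 5 * harmonic n : R) @ \oo --> (0 : R).
  by rewrite -[X in _ --> X](mulr0 5); apply: cvgMr; exact: cvg_harmonic.
apply: (squeeze_cvgr _ (cvg_cst 0) h0); near=> n; rewrite invr_ge0 ler0n/=.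
have n3 : (2 < n)%N by near: n; exact: nbhs_infty_gt.
have m0 : (0 < (n - 1)./2)%N by lia.
rewrite /= ler_pdivlMr ?ltr0n// mulrC ler_pdivrMr ?ltr0n//.
by rewrite -natrM ler_nat; lia.
Unshelve. all: by end_near. Qed.

Theorem proposition4p4 (R : realType) (H : set nat)
    (H_pos : H `<=` posnat)
    (density_ex : cvgn (density_seq R H))
    (axial_density_ex : cvgn (axial_density_seq R H)) :
  let lower : nat -> R :=
    fun n => ((count_upto H n)./2)%:R / ((n - 1)./2)%:R in
  let upper : nat -> R :=
    fun n => (count_upto H n)%:R / ((n - 1)./2)%:R in
  [/\ cvgn lower, cvgn upper &
      [/\ density R H = limn lower,
          limn lower <= axial_density R H,
          axial_density R H <= limn upper &
          limn upper = 2 * density R H]].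
Proof.
move=> lower upper.
pose e n : R := ((n - 1)./2)%:R^-1.
have e0 : e @ \oo --> (0 : R) by exact: cvg_inv_half.
have e_ge0 n : 0 <= e n by rewrite invr_ge0.
have twice_density : (fun n => 2 * density_seq R H n) @ \oo --> 2 * density R H.
  by apply: cvgMr.
have upper_cvg : upper @ \oo --> 2 * density R H.
  (* With [m = (n - 1)./2], the bounds [2m <= n <= 2m + 2] and [h <= n] give
     [2h/n <= h/m <= 2h/n + 2/m]. *)
  have ub : (fun n => 2 * density_seq R H n + 2 * e n) @ \oo --> 2 * density R H.
    rewrite -[X in _ --> X]addr0 -[X in _ + X](mulr0 2).
    by apply: cvgD => //; apply: cvgMr.
  apply: (squeeze_cvgr _ twice_density ub); near=> n.
  have n3 : (2 < n)%N by near: n; exact: nbhs_infty_gt.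
  rewrite /density_seq /upper /e.
  have hn := count_upto_le H n.
  set h := count_upto H n in hn *; set m := ((n - 1)./2)%N.
  have m0 : 0 < m%:R :> R by rewrite ltr0n /m; lia.
  have n0 : 0 < n%:R :> R by rewrite ltr0n; lia.
  have hn' : h%:R <= n%:R :> R by rewrite ler_nat.
  have h0 : 0 <= h%:R :> R by [].
  have mn : 2 * m%:R <= n%:R :> R by rewrite -natrM ler_nat /m; lia.
  have nm : n%:R <= 2 * m%:R + 2 :> R.
    by rewrite -natrM -natrD ler_nat /m; lia.
  apply/andP; split.
    rewrite mulrA ler_pdivrMr// mulrAC ler_pdivlMr//.
    by rewrite mulrAC [leLHS]mulrC ler_wpM2l.
  have hn1 : h%:R / n%:R <= 1 :> R by rewrite ler_pdivrMr// mul1r.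
  rewrite ler_pdivrMr// mulrDl -[2 / _ * _]mulrA mulVf ?gt_eqF// mulr1.
  rewrite -[leLHS](divfK (_ : n%:R != 0)) ?gt_eqF//.
  apply: (le_trans (ler_wpM2l _ nm)); first exact: divr_ge0.
  rewrite mulrDr mulrCA mulrA lerD2l.
  by rewrite -[leRHS]mul1r ler_wpM2r.
have half_upper : (fun n => 2^-1 * upper n) @ \oo --> density R H.
  by rewrite -[X in _ --> X](mulKf (_ : 2 != 0 :> R))//; apply: cvgMr.
have lower_cvg : lower @ \oo --> density R H.
  (* Rounding [h/2] down loses less than 1, hence at most [e n] after division. *)
  have lb : (fun n => 2^-1 * upper n - e n) @ \oo --> density R H.
    by rewrite -[X in _ --> X]subr0; apply: cvgB.
  apply: (squeeze_cvgr _ lb half_upper); near=> n.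
  rewrite /lower /upper -/(e n) mulrA -[X in _ - X]mul1r -mulrBl.
  rewrite !ler_wpM2r//.
    have : (2 * (count_upto H n)./2)%:R <= (count_upto H n)%:R :> R.
      by rewrite ler_nat; lia.
    by rewrite natrM ler_pdivlMl.
  have : (count_upto H n)%:R <= (2 * (count_upto H n)./2 + 2)%:R :> R.
    by rewrite ler_nat; lia.
  by rewrite natrD natrM lerBlDr ler_pdivrMl// mulrDr mulr1.
have lower_lim := cvg_lim (@Rhausdorff R) lower_cvg.
have upper_lim := cvg_lim (@Rhausdorff R) upper_cvg.
split; [by apply: cvgP lower_cvg|by apply: cvgP upper_cvg|].
split; [by rewrite lower_lim| | |exact: upper_lim].
(* From [h <= 2a + 2] only [h./2 <= a + 1] follows; adding the vanishing [e n] absorbs the extra 1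
   without changing the limit. *)
- have axial_e : (fun n => axial_density_seq R H n + e n) @ \oo -->
      axial_density R H.
    by rewrite -[X in _ --> X]addr0; apply: cvgD.
  rewrite -(cvg_lim (@Rhausdorff R) axial_e).
  apply: ler_lim; [by apply: cvgP lower_cvg|by apply: cvgP axial_e|].
  near=> n; rewrite /lower /axial_density_seq -/(e n) -[X in _ + X]mul1r -mulrDl.
  rewrite ler_wpM2r// natr1 ler_nat.
  by have := count_upto_le_axes H n; lia.
- apply: ler_lim => //; first by apply: cvgP upper_cvg.
  near=> n; rewrite /axial_density_seq /upper ler_wpM2r// ler_nat.
  exact: card_axes_meeting_le.
Unshelve. all: by end_near. Qed.
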